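(* For every positive integer $r$, all pure $O$-sequences of codimension $r$ and type $1$ are log-concave.
   Context: A pure $O$-sequence of codimension $r$, type $t$ and socle degree $e$ is a sequence $h=(1,h_1=r,h_2,\dots,h_e=t)$ of positive integers for which there exist $t$ distinct (monic) monomials of degree $e$ in $r$ variables such that, for every $i$ with $0\le i\le e$, the number of distinct monomials of degree $i$ dividing at least one of these $t$ monomials is $h_i$ (in particular, since $h_1=r$, every variable divides at least one of them). Equivalently, it is the Hilbert function of a level artinian standard graded algebra of codimension $r$ and type $t$ defined by a monomial ideal. A sequence $(a_n)_{n\in\mathbb N}$ is log-concave if $a_{i-1}a_{i+1}\le a_i^2$ for all indices $i\ge 1$; a pure $O$-sequence $(1,h_1,\dots,h_e)$ is regarded as such a sequence with $h_i=0$ for $i>e$. *)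

(* Defs.v *)
From mathcomp Require Import all_boot.
From mathcomp Require Import mpoly.

Set Implicit Arguments.
Unset Strict Implicit.
Unset Printing Implicit Defensive.

(* A monomial is its exponent vector, so divisibility is the componentwise
   order (_ <= _)%MM of mpoly.v. The type 'X_{1..r < i.+1} of monomials of
   degree at most i only serves to make the set finite. *)
Definition divisors_of_degree (r : nat) (s : seq 'X_{1..r}) (i : nat) :
    {set 'X_{1..r < i.+1}} :=
  [set m : 'X_{1..r < i.+1} |
    (mdeg m == i) && has (fun M : 'X_{1..r} => (m <= M)%MM) s].

(* The default value 0 of nth never satisfies h_1 = r when 0 < r, so for such r
   the first conditions force e >= 1. *)
Definition pure_O_sequence (r t e : nat) (h : seq nat) : Prop :=
  [/\ size h = e.+1,
      [/\ nth 0 h 0 = 1, nth 0 h 1 = r & nth 0 h e = t],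
      (forall i, i <= e -> 0 < nth 0 h i)
    & exists s : seq 'X_{1..r},
        [/\ uniq s, size s = t,
            (forall M, M \in s -> mdeg M = e)
          & forall i, i <= e -> nth 0 h i = #|divisors_of_degree s i| ] ].

Definition log_concave (a : nat -> nat) : Prop :=
  forall i, 1 <= i -> a i.-1 * a i.+1 <= a i ^ 2.

(* Main.v *)
(** The divisors of a monomial with exponents [a_1, ..., a_r] are counted by
    degree by the coefficients of the product of the polynomials
    [1 + X + ... + X^a_j]. It therefore suffices that multiplying by such a
    factor preserves nonnegativity of all 2x2 minors of the Toeplitz matrix of
    the coefficients; unlike plain log-concavity, this condition rules out
    internal zeros. *)
Require Import Defs.
From mathcomp Require Import all_boot all_algebra.
From mathcomp Require Import zify.
From mathcomp Require Import mpoly.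

Set Implicit Arguments.
Unset Strict Implicit.
Unset Printing Implicit Defensive.

Definition toeplitz2_nonneg (f : nat -> nat) : Prop :=
  forall i j d, i <= j -> f i * f (j + d) <= f (i + d) * f j.

Lemma toeplitz2_nonneg_log_concave (f : nat -> nat) :
  toeplitz2_nonneg f -> log_concave f.
Proof.
by move=> f2 [//|i] _ /=; have := f2 i i.+1 1 (leqnSn i); rewrite !addn1 mulnn.
Qed.

(** Unit shifts chain: [f i * f (j + d) <= f i.+1 * f (j + d).-1 <= ...], the two indices moving
    towards each other. No division occurs, so zeros of [f] are harmless. *)
Lemma toeplitz2_nonneg_step (f : nat -> nat) :
  (forall i j, i <= j -> f i * f j.+1 <= f i.+1 * f j) -> toeplitz2_nonneg f.
Proof.
move=> f1.
have fd d : forall i j, i + d <= j -> f i * f (j + d) <= f (i + d) * f j.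
  elim: d => [|d IHd] i j le_ij; first by rewrite !addn0.
  rewrite addnS -addSnnS; apply: leq_trans (f1 _ _ _) _; first by lia.
  by apply: IHd; rewrite addSnnS.
move=> i j d le_ij; have [/fd //|lt_j] := leqP (i + d) j.
(* Exchanging the roles of [i + d] and [j] replaces [d] by [j - i]. *)
have := fd (j - i) i (i + d); rewrite subnKC // => /(_ (ltnW lt_j)).
by rewrite [_ * f (i + d)]mulnC; have -> : i + d + (j - i) = j + d by lia.
Qed.

(** With [U] and [V] the sums over the shared indices [1..a], the claim is [(U + x a.+1) * (y 0 + V)
    <= (x 0 + U) * (V + y a.+1)]. The term [U * V] cancels and the other three products compare
    separately. *)
Lemma leq_mul_sum_shift (x y : nat -> nat) (a : nat) :
  (forall k l, k <= l -> x l * y k <= x k * y l) ->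
  (\sum_(k < a.+1) x k.+1) * (\sum_(k < a.+1) y k)
    <= (\sum_(k < a.+1) x k) * (\sum_(k < a.+1) y k.+1).
Proof.
move=> xy; rewrite [X in X * _]big_ord_recr [X in _ * X <= _]big_ord_recl.
rewrite [X in _ <= X * _]big_ord_recl [X in _ <= _ * X]big_ord_recr /=.
set U := \sum_(k < a) x k.+1; set V := \sum_(k < a) y k.+1.
have UV0 : U * y 0 <= x 0 * V.
  by rewrite big_distrl big_distrr /=; apply: leq_sum => k _; apply: xy.
have UVa : x a.+1 * V <= U * y a.+1.
  rewrite big_distrl big_distrr /=; apply: leq_sum => k _; apply: xy.
  by rewrite ltnS ltnW.
by have := xy 0 a.+1 isT; rewrite !mulnDl !mulnDr; lia.
Qed.

Section GeometricFactor.

Import GRing.Theory.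
Local Open Scope ring_scope.

Lemma toeplitz2_nonneg_geom_mul (a : nat) (p : {poly nat}) :
  toeplitz2_nonneg (fun i => p`_i) ->
  toeplitz2_nonneg (fun i => ((\sum_(k < a.+1) 'X^k) * p)`_i).
Proof.
move=> p2; apply: toeplitz2_nonneg_step => i j le_ij.
pose c n k := ('X^k * p)`_n.
have cE n : ((\sum_(k < a.+1) 'X^k) * p)`_n = (\sum_(k < a.+1) c n k)%N.
  by rewrite mulr_suml coef_sum.
have cS n k : c n k = c n.+1 k.+1 by rewrite /c !coefXnM ltnS subSS.
have cS_sum n : (\sum_(k < a.+1) c n k = \sum_(k < a.+1) c n.+1 k.+1)%N.
  by apply: eq_bigr => k _; apply: cS.
(* The coefficients at [i] and [j] become shifted sums over the rows [i.+1] and [j.+1], so only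
   these two rows remain. *)
rewrite !cE (cS_sum i) (cS_sum j).
apply: (leq_mul_sum_shift (x := c i.+1) (y := c j.+1)) => k l le_kl.
rewrite /c !coefXnM.
(* If [l] exceeds [i.+1], the left side vanishes; otherwise no subtraction truncates, and the claim
   is a minor of [p] with shift [l - k]. *)
case: (ltnP i.+1 l) => [|le_li]; first by rewrite mul0n.
rewrite !ifF; try by apply/negbTE; rewrite -leqNgt; lia.
have := p2 (i.+1 - l)%N (j.+1 - l)%N (l - k)%N.
have -> : (i.+1 - l + (l - k) = i.+1 - k)%N by lia.
have -> : (j.+1 - l + (l - k) = j.+1 - k)%N by lia.
by apply; lia.
Qed.

Lemma toeplitz2_nonneg_prod_geom (r : nat) (m : 'X_{1..r}) :
  toeplitz2_nonneg
    (fun i => (\prod_(j < r) \sum_(k < (m j).+1) 'X^k : {poly nat})`_i).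
Proof.
elim/big_rec: _ => [|j p _]; last exact: toeplitz2_nonneg_geom_mul.
by move=> i j [|d] le_ij; rewrite ?addn0 // !coef1 addnS muln0.
Qed.

Lemma card_divisors_of_degree (r : nat) (M : 'X_{1..r}) (i : nat) :
  #|divisors_of_degree [:: M] i|
    = (\prod_(j < r) \sum_(k < (M j).+1) 'X^k : {poly nat})`_i.
Proof.
set e := mdeg M.
have leM (m : 'X_{1..r}) j : (m <= M)%MM -> (m j < e.+1)%N.
  move=> /mnm_lepP leM; rewrite ltnS (leq_trans (leM j)) // /e mdegE.
  by rewrite (bigD1 j) //= leq_addr.
(* Distributing the product into a sum over functions needs one index type for all factors, hence
   the common bound [e]. *)
have -> : \prod_(j < r) \sum_(k < (M j).+1) 'X^k
    = \prod_(j < r) \sum_(k < e.+1 | (k <= M j)%N) 'X^k :> {poly nat}.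
  apply: eq_bigr => j _.
  by rewrite (big_ord_widen_cond e.+1 predT (fun k => 'X^k)) ?leM ?lepm_refl.
have -> := bigA_distr_big_dep (times := *%R) (plus := +%R)
  (fun (j : 'I_r) (k : 'I_e.+1) => (k <= M j)%N) (fun _ k => 'X^k : {poly nat}).
rewrite coef_sum.
under eq_bigr do rewrite -expr_sum coefXn.
(* [inord] preserves the exponents only up to [e]; [phi] is used on divisors of [M] alone, where
   this bound holds. *)
pose phi (m : 'X_{1..r < i.+1}) := [ffun j => inord (m j) : 'I_e.+1].
have phiE (m : 'X_{1..r < i.+1}) j : (m <= M)%MM -> phi m j = m j :> nat.
  by move=> le_mM; rewrite ffunE inordK ?leM.
pose B := [set f : {ffun 'I_r -> 'I_e.+1}
  | (f \in family (fun j (k : 'I_e.+1) => (k <= M j)%N))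
    & i == (\sum_j f j)%N].
have phi_im : phi @: divisors_of_degree [:: M] i = B.
  apply/setP=> f; rewrite /B in_set; apply/imsetP/andP.
    case=> m; rewrite inE /= orbF => /andP[/eqP deg_m le_mM] ->; split.
      by apply/familyP => j; rewrite unfold_in phiE //; apply/mnm_lepP.
    by rewrite -deg_m mdegE; apply/eqP/eq_bigr => j _; rewrite phiE.
  case=> /familyP leM_f /eqP deg_f.
  pose m : 'X_{1..r} := [multinom f j : nat | j < r].
  have deg_m : mdeg m = i.
    by rewrite mdegE deg_f; apply: eq_bigr => j _; rewrite mnmE.
  have lt_m : (mdeg m < i.+1)%N by rewrite deg_m.
  have le_mM : (m <= M)%MM by apply/mnm_lepP => j; rewrite mnmE; apply: leM_f.
  exists (BMultinom lt_m); first by rewrite inE /= deg_m eqxx le_mM.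
  by apply/ffunP => j; apply/val_inj; rewrite /= phiE //= mnmE.
rewrite -(card_in_imset (f := phi)) ?phi_im => [|m m'].
  by rewrite cardsE -sum1_card big_mkcondr; apply: eq_bigr => f _; case: eqP.
rewrite !inE /= !orbF => /andP[_ le_mM] /andP[_ le_m'M] /ffunP eq_phi.
by apply/val_inj/mnmP => j; rewrite -!phiE // eq_phi.
Qed.

End GeometricFactor.

Theorem proposition7 (r : nat) (hr : 0 < r) (e : nat) (h : seq nat)
  (hh : pure_O_sequence r 1 e h) : log_concave (nth 0 h).
Proof.
case: hh => size_h _ _ [[|M [|? ?]] [_ // _ _ hE]] i i_gt0.
(* Beyond degree [e] the default value of [nth] makes the left side zero. *)
have [le_ie | lt_ei] := leqP i.+1 e; last first.
  by rewrite [X in _ * X]nth_default ?muln0 // size_h.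
rewrite !hE ?card_divisors_of_degree; try lia.
exact: toeplitz2_nonneg_log_concave (toeplitz2_nonneg_prod_geom M) i i_gt0.
Qed.
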